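(* Let $\Lambda$ be a solid partition, and let $\mathcal V_\Lambda=\{V(i,j,k):(i,j,k)\in\Lambda\}$ and $\mathcal V^\ast_\Lambda=\{V^\ast(i,j,k):(i,j,k)\in\Lambda\}$ be the multisets of volume and anti-volume numbers. Then $\mathcal V_\Lambda$ majorizes $\mathcal V^\ast_\Lambda$.
   Context: A solid partition $\Lambda$ is a finite subset of $\mathbb Z_{\ge0}^3$ that is a lower order ideal for the componentwise order: if $(i,j,k)\in\Lambda$ and $0\le p\le i$, $0\le q\le j$, $0\le r\le k$, then $(p,q,r)\in\Lambda$. For $(i,j,k)\in\Lambda$: $V(i,j,k)=|\{(p,q,r)\in\Lambda: i\le p,\ j\le q,\ k\le r\}|$ and $V^\ast(i,j,k)=|\{(p,q,r)\in\Lambda:p\le i,\ q\le j,\ r\le k\}|$. Majorization: for two multisets $\mathcal A,\mathcal B$ of $n$ real numbers with elements $a_1\ge\dots\ge a_n$ and $b_1\ge\dots\ge b_n$ in non-increasing order, $\mathcal A$ majorizes $\mathcal B$ if $a_1+\dots+a_k\ge b_1+\dots+b_k$ for all $1\le k<n$ and $a_1+\dots+a_n=b_1+\dots+b_n$. *)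

(* Defs.v *)
From mathcomp Require Import all_boot all_order all_algebra.
From mathcomp Require Import finmap multiset reals.

Set Implicit Arguments.
Unset Strict Implicit.
Unset Printing Implicit Defensive.

Import Order.TTheory GRing.Theory Num.Theory.

Local Open Scope fset_scope.
Local Open Scope mset_scope.

Definition solid_partition (L : {fset nat * nat * nat}) : Prop :=
  forall i j k p q r : nat, (i, j, k) \in L ->
    (p <= i)%N -> (q <= j)%N -> (r <= k)%N -> (p, q, r) \in L.

Definition volume (L : {fset nat * nat * nat}) (x : nat * nat * nat) : nat :=
  #|` [fset y in L | [&& x.1.1 <= y.1.1, x.1.2 <= y.1.2 & x.2 <= y.2]%N]|.

Definition antivolume (L : {fset nat * nat * nat}) (x : nat * nat * nat) : nat :=
  #|` [fset y in L | [&& y.1.1 <= x.1.1, y.1.2 <= x.1.2 & y.2 <= x.2]%N]|.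

(* The image is taken with multiplicity, over the duplicate-free enumeration
   of L; the natural numbers are embedded in R. *)
Definition volume_mset (R : realType) (L : {fset nat * nat * nat}) : {mset R} :=
  seq_mset [seq (volume L x)%:R%R | x <- enum_fset L].

Definition antivolume_mset (R : realType) (L : {fset nat * nat * nat}) :
    {mset R} :=
  seq_mset [seq (antivolume L x)%:R%R | x <- enum_fset L].

Local Open Scope ring_scope.

Definition decr (R : realType) (A : {mset R}) : seq R := sort >=%R A.

Definition majorizes (R : realType) (A B : {mset R}) : Prop :=
  [/\ size A = size B,
      forall k : nat, (1 <= k < size A)%N ->
        \sum_(i < k) (decr A)`_i >= \sum_(i < k) (decr B)`_i
    & \sum_(i < size A) (decr A)`_i = \sum_(i < size B) (decr B)`_i].

(* Main.v *)
Require Import Defs.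
From mathcomp Require Import all_boot all_order all_algebra.
From mathcomp Require Import finmap multiset reals.
From mathcomp Require Import zify.

Local Open Scope mset_scope.

(** For equal total sums, [A] majorizes [B] as soon as
    [sum_A max(a - t, 0) >= sum_B max(b - t, 0)] for every [t].  In one
    dimension, a nonincreasing sequence [c_0 >= c_1 >= ...] has the property
    that its tail sums [c_q + c_(q+1) + ...] dominate the numbers
    [(q + 1) c_q] in this sense.  The anti-volume of [(i, j, k)] in [L] is
    [(i + 1) (j + 1) (k + 1)] times the indicator function of [L], and the
    volume is obtained from that indicator by taking tail sums in each of the
    three directions.  Replacing one factor at a time by a tail sum, line by
    line, therefore leads from anti-volumes to volumes: tail sums in one
    direction remain nonincreasing in the others.  Truncated subtraction on
    [nat] plays the role of [max(a - t, 0)]. *)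

(** * Tail sums of nonincreasing functions *)

(** Both sums run over truncated multiples of [c], shifted by one: the left has the extra multiple
    [n.+1 * c], the right the zero multiple, which contributes [0 - t = 0]. *)
Lemma sum_mul_subn_telescope (c t n : nat) :
  \sum_(q < n.+1) ((n - q) * c + c - t) =
  (n.+1 * c - t) + \sum_(q < n.+1) ((n - q) * c - t).
Proof.
transitivity (\sum_(q < n.+2) ((n.+1 - q) * c - t)).
  rewrite [RHS]big_ord_recr /= subnn mul0n sub0n addn0.
  apply: eq_bigr => -[q /= Hq] _.
  by rewrite subSn // mulSn [c + _]addnC.
by rewrite big_ord_recl /= subn0; congr (_ + _); apply: eq_bigr.
Qed.

Lemma sum_tail_dominates (c : nat -> nat) (t n : nat) :
  {homo c : p q / p <= q >-> q <= p} ->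
  \sum_(q < n) (q.+1 * c q - t) <= \sum_(q < n) (\sum_(p < n | q <= p) c p - t).
Proof.
move=> c_dec; elim: n => [|n IHn]; first by rewrite !big_ord0.
set T := fun q => \sum_(p < n | q <= p) c p.
have TS (q : 'I_n.+1) : \sum_(p < n.+1 | q <= p) c p = T q + c n.
  by rewrite big_mkcond big_ord_recr /= -big_mkcond /= -ltnS ltn_ord.
have T_ge (q : 'I_n.+1) : (n - q) * c n <= T q.
  apply: leq_trans (_ : \sum_(p < n | q <= p) c n <= _); last first.
    by apply: leq_sum => p _; apply/c_dec/ltnW.
  rewrite sum_nat_const leq_mul2r; apply/orP; right.
  rewrite -sum1_card.
  have -> : \sum_(p < n | q <= p) 1 = \sum_(q <= p < n) 1.
    by rewrite (big_nat_widenl q 0) // big_mkord.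
  by rewrite sum_nat_const_nat muln1.
have T0 : T n = 0 by rewrite /T big_pred0 // => p; rewrite leqNgt ltn_ord.
rewrite big_ord_recr /= (eq_bigr _ (fun q _ => congr1 (subn^~ t) (TS q))).
(* By convexity of x |-> max(x - t, 0), appending c_n increases the right-hand
   side at least as much as if T q were equal to its lower bound (n - q) c_n;
   there the increase telescopes to the new term on the left. *)
have cvx :
    \sum_(q < n.+1) (T q - t) + \sum_(q < n.+1) ((n - q) * c n + c n - t)
    <= \sum_(q < n.+1) (T q + c n - t) + \sum_(q < n.+1) ((n - q) * c n - t).
  rewrite -!big_split /=; apply: leq_sum => q _.
  by move: (T_ge q) => ?; lia.
rewrite -(leq_add2r (\sum_(q < n.+1) ((n - q) * c n - t))).
apply: leq_trans cvx; rewrite -addnA -sum_mul_subn_telescope leq_add2r.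
(* The empty tail [T n] contributes a zero term; what remains is the induction hypothesis. *)
by rewrite big_ord_recr /= T0 sub0n addn0.
Qed.

Lemma sum3_tail_dominates (n t : nat) (c : nat -> nat -> nat -> nat) :
  (forall i j k i' j' k', i <= i' -> j <= j' -> k <= k' ->
     c i' j' k' <= c i j k) ->
  \sum_(i < n) \sum_(j < n) \sum_(k < n) (i.+1 * j.+1 * k.+1 * c i j k - t) <=
  \sum_(i < n) \sum_(j < n) \sum_(k < n)
    (\sum_(p < n | i <= p) \sum_(q < n | j <= q) \sum_(r < n | k <= r)
       c p q r - t).
Proof.
move=> c_dec.
pose c1 i j k := \sum_(p < n | i <= p) c p j k.
pose c2 i j k := \sum_(q < n | j <= q) c1 i q k.
apply: leq_trans (_ : \sum_(i < n) \sum_(j < n) \sum_(k < n)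
                        (j.+1 * k.+1 * c1 i j k - t) <= _).
  (* The treated index moves innermost; the other factors are absorbed into the sequence, which
     stays nonincreasing in that index. *)
  rewrite exchange_big [leqRHS]exchange_big; apply: leq_sum => j _ /=.
  rewrite exchange_big [leqRHS]exchange_big; apply: leq_sum => k _ /=.
  rewrite (eq_bigr (fun i : 'I_n => i.+1 * (j.+1 * k.+1 * c i j k) - t));
    last by move=> i _; rewrite !mulnA.
  apply: leq_trans
    (sum_tail_dominates (fun i => j.+1 * k.+1 * c i j k) t n _) _ => [p q pq|].
    by rewrite leq_mul2l c_dec ?orbT.
  by apply: leq_sum => i _; rewrite -big_distrr.
apply: leq_trans (_ : \sum_(i < n) \sum_(j < n) \sum_(k < n)
                        (k.+1 * c2 i j k - t) <= _).
  apply: leq_sum => i _.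
  rewrite exchange_big [leqRHS]exchange_big; apply: leq_sum => k _ /=.
  rewrite (eq_bigr (fun j : 'I_n => j.+1 * (k.+1 * c1 i j k) - t));
    last by move=> j _; rewrite !mulnA.
  apply: leq_trans (sum_tail_dominates (fun j => k.+1 * c1 i j k) t n _) _.
    by move=> p q pq; rewrite leq_mul2l leq_sum ?orbT // => r _; apply: c_dec.
  by apply: leq_sum => j _; rewrite -big_distrr.
apply: leq_sum => i _; apply: leq_sum => j _.
apply: leq_trans (sum_tail_dominates (c2 i j) t n _) _.
  by move=> p q pq; do 2!(apply: leq_sum => ? _); apply: c_dec.
apply: leq_sum => k _; apply: leq_sub2r; apply: eq_leq.
(* The successive tail sums are nested in the reverse order of the goal. *)
rewrite /c2 /c1 exchange_big.
rewrite (eq_bigr _ (fun q _ => exchange_big _ _ _ _ _ _)) exchange_big /=.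
by apply: eq_bigr => p _; rewrite exchange_big.
Qed.

(** * From truncated sums to majorization *)

(** For every [t], a sum of [k] entries is at most [k * t] plus the full truncated sum. Equality
    holds for the [k] largest entries of [s2] when [t] separates them from the rest. *)
Lemma sumn_take_sort_dominates (s1 s2 : seq nat) (k : nat) :
  k < size s2 -> size s1 = size s2 ->
  (forall t, \sum_(x <- s1) (x - t) <= \sum_(x <- s2) (x - t)) ->
  \sum_(x <- take k (sort geq s1)) x <= \sum_(x <- take k (sort geq s2)) x.
Proof.
move=> k_lt eq_sz dom; have k_lt1 : k < size s1 by rewrite eq_sz.
(* [t] is the first entry left out by [take k], a genuine entry since [k < size s2]. *)
set u := sort geq s2; set t := nth 0 u k.
have geq_tr : transitive geq by move=> x y z /= xy yz; apply: leq_trans yz xy.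
have geq_tot : total geq by move=> x y; apply: leq_total.
have u_sorted : sorted geq u by apply: sort_sorted.
have sz_u : size u = size s2 by rewrite size_sort.
have take_ge x : x \in take k u -> t <= x.
  case/(nthP 0) => i; rewrite size_take sz_u k_lt => ik <-.
  rewrite nth_take // /t.
  apply: (sorted_leq_nth geq_tr leqnn 0 u_sorted); rewrite ?inE ?sz_u; lia.
have drop_le x : x \in drop k u -> x <= t.
  case/(nthP 0) => i; rewrite size_drop sz_u => ik <-.
  rewrite nth_drop /t.
  apply: (sorted_leq_nth geq_tr leqnn 0 u_sorted); rewrite ?inE ?sz_u; lia.
have sum_const (s : seq nat) : \sum_(x <- s) t = size s * t.
  by rewrite big_const_seq count_predT iter_addn_0 mulnC.
apply: leq_trans (_ : \sum_(x <- take k (sort geq s1)) (x - t) + k * t <= _).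
  have -> : k * t = \sum_(x <- take k (sort geq s1)) t.
    by rewrite sum_const size_take size_sort k_lt1.
  by rewrite -big_split; apply: leq_sum => x _ /=; lia.
apply: leq_trans (_ : \sum_(x <- s1) (x - t) + k * t <= _).
  rewrite leq_add2r -(perm_big _ (permEl (perm_sort geq s1))) /=.
  by rewrite -{2}(cat_take_drop k (sort geq s1)) big_cat leq_addr.
apply: leq_trans (_ : \sum_(x <- s2) (x - t) + k * t <= _).
  by rewrite leq_add2r.
rewrite -(perm_big _ (permEl (perm_sort geq s2))) /= -/u.
rewrite -{1}(cat_take_drop k u) big_cat /=.
have -> : \sum_(x <- drop k u) (x - t) = 0.
  by rewrite big_seq big1 // => x /drop_le; rewrite -subn_eq0 => /eqP.
have -> : k * t = \sum_(x <- take k u) t.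
  by rewrite sum_const size_take sz_u k_lt.
rewrite addn0 -big_split big_seq [leqRHS]big_seq.
by apply: leq_sum => x /take_ge /=; lia.
Qed.

(** The embedding preserves and reflects order, hence commutes with sorting; a [seq_mset] enumerates
    its list only up to permutation, which sorting erases. *)
Lemma decr_seq_mset_natr (R : realType) (s : seq nat) :
  decr (seq_mset [seq x%:R%R | x <- s] : {mset R}) =
  [seq x%:R%R | x <- sort geq s].
Proof.
have natr_mono : {mono (fun x => x%:R%R : R) : x y / geq x y >-> (x >= y)%R}.
  by move=> x y; rewrite Num.Theory.ler_nat.
rewrite (map_sort natr_mono); apply/perm_sortP.
- exact: Order.TotalTheory.ge_total.
- exact: Order.POrderTheory.ge_trans.
- exact: Order.POrderTheory.ge_anti.
- exact: perm_eq_seq_mset.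
Qed.

Lemma majorizes_natr (R : realType) (s1 s2 : seq nat) :
  size s1 = size s2 -> \sum_(x <- s1) x = \sum_(x <- s2) x ->
  (forall t, \sum_(x <- s2) (x - t) <= \sum_(x <- s1) (x - t)) ->
  majorizes (seq_mset [seq x%:R%R | x <- s1] : {mset R})
            (seq_mset [seq x%:R%R | x <- s2]).
Proof.
move=> eq_sz eq_sum dom.
have sz s : size (seq_mset [seq x%:R%R | x <- s] : {mset R}) = size s.
  by rewrite (perm_size (perm_eq_seq_mset _)) size_map.
(* Allowing [k = size s] lets the same identity settle the total sums. *)
have sum_decr s k : k <= size s ->
    (\sum_(i < k) (decr (seq_mset [seq x%:R | x <- s] : {mset R}))`_i =
     (\sum_(x <- take k (sort geq s)) x)%:R)%R.
  move=> k_le; rewrite decr_seq_mset_natr GRing.natr_sum.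
  have sz_take : size (take k (sort geq s)) = k.
    by rewrite size_take size_sort; case: ltngtP k_le.
  rewrite (big_nth 0) sz_take big_mkord; apply: eq_bigr => i _.
  by rewrite (nth_map 0) ?size_sort ?nth_take // (leq_trans _ k_le).
split; first by rewrite !sz.
- move=> k /andP[_]; rewrite sz => k_lt.
  rewrite !sum_decr -?eq_sz ?(ltnW k_lt) // Num.Theory.ler_nat.
  exact: sumn_take_sort_dominates.
- rewrite !sz !sum_decr // !take_oversize ?size_sort //.
  by rewrite !(perm_big _ (permEl (perm_sort _ _))) /= eq_sum.
Qed.

(** * Counting inside a bounding cube *)

Lemma fset_bound (L : {fset nat * nat * nat}) :
  exists n, forall i j k, (i, j, k) \in L -> [&& i < n, j < n & k < n].
Proof.
(* Every coordinate of a point of [L] is part of this sum; the successor makes the bound strict. *)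
exists (\sum_(x <- L) (x.1.1 + x.1.2 + x.2)).+1 => i j k ijkL.
by rewrite (big_fsetD1 _ ijkL) /= !ltnS; lia.
Qed.

(** Indicator weights on a cube make the three directions independent, so that tail sums can be
    taken in each. *)
Lemma sum_fset_box (L : {fset nat * nat * nat}) (n : nat)
    (F : nat * nat * nat -> nat) :
  (forall i j k, (i, j, k) \in L -> [&& i < n, j < n & k < n]) ->
  \sum_(x <- L) F x =
  \sum_(i < n) \sum_(j < n) \sum_(k < n)
    ((i : nat, j : nat, k : nat) \in L) * F (i : nat, j : nat, k : nat).
Proof.
move=> L_bound.
pose box := [seq (ij, k) | ij <- [seq (i, j) | i <- iota 0 n, j <- iota 0 n],
                          k <- iota 0 n].
have mem_box i j k : (i, j, k) \in box = [&& i < n, j < n & k < n].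
  apply/allpairsP/and3P => [[[pq r] /= []]|[lt_in lt_jn lt_kn]].
    case/allpairsP => -[p q] /=; rewrite !mem_iota => -[? ? ->] ?.
    by case=> -> -> ->.
  exists (i, j, k); rewrite mem_iota; split=> //.
  by apply/allpairsP; exists (i, j); rewrite !mem_iota.
have box_uniq : uniq box.
  by rewrite !allpairs_uniq ?iota_uniq // => -[? ?] [? ?] _ _ [] -> ->.
have L_box : perm_eq L [seq x <- box | x \in L].
  apply: uniq_perm; rewrite ?fset_uniq ?filter_uniq //.
  move=> [[i j] k]; rewrite mem_filter mem_box.
  by case: (boolP (_ \in L)) => //= /L_bound.
rewrite (perm_big _ L_box) big_filter big_mkcond /=.
have iotaE : iota 0 n = index_iota 0 n by rewrite /index_iota subn0.
rewrite !big_allpairs_dep iotaE.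
rewrite big_mkord; apply: eq_bigr => i _.
rewrite big_mkord; apply: eq_bigr => j _.
rewrite big_mkord; apply: eq_bigr => k _.
by case: ifP => _; rewrite ?mul1n ?mul0n.
Qed.

Lemma card_fset_filter (K : choiceType) (L : {fset K}) (P : pred K) :
  #|` [fset y in L | P y]%fset| = \sum_(y <- L) P y.
Proof.
transitivity (size [seq y <- L | P y]).
  apply/perm_size/uniq_perm; rewrite ?fset_uniq ?filter_uniq ?fset_uniq //.
  by move=> y; rewrite mem_filter !inE andbC.
rewrite size_filter -sum1_count big_mkcond.
by apply: eq_bigr => y _; case: (P y).
Qed.

(** Double counting: both sides count the pairs of points of [L] that are comparable in a given
    order. *)
Lemma sum_volume (L : {fset nat * nat * nat}) :
  \sum_(x <- L) volume L x = \sum_(x <- L) antivolume L x.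
Proof.
rewrite /volume /antivolume.
rewrite (eq_bigr _ (fun x _ => card_fset_filter _ _ _)) exchange_big /=.
by apply: eq_bigr => x _; rewrite -card_fset_filter.
Qed.

Lemma volume_sum (L : {fset nat * nat * nat}) (n i j k : nat) :
  (forall i j k, (i, j, k) \in L -> [&& i < n, j < n & k < n]) ->
  volume L (i, j, k) =
  \sum_(p < n | i <= p) \sum_(q < n | j <= q) \sum_(r < n | k <= r)
    ((p : nat, q : nat, r : nat) \in L).
Proof.
move=> L_bound; rewrite /volume card_fset_filter.
rewrite (sum_fset_box _ _ _ L_bound) /=.
rewrite [RHS]big_mkcond; apply: eq_bigr => p _.
case: leqP => _ /=; last first.
  by rewrite big1 // => q _; rewrite big1 // => r _; rewrite muln0.
rewrite [RHS]big_mkcond; apply: eq_bigr => q _.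
case: leqP => _ /=; last by rewrite big1 // => r _; rewrite muln0.
rewrite [RHS]big_mkcond; apply: eq_bigr => r _.
by case: leqP => _ /=; rewrite ?muln0 ?muln1.
Qed.

Lemma sum_ord_leq_const (n i m : nat) :
  i < n -> \sum_(p < n) (p <= i) * m = i.+1 * m.
Proof.
move=> lt_in; rewrite -[i.+1 in RHS]card_ord -sum_nat_const.
rewrite (big_ord_widen n (fun=> m) lt_in) [RHS]big_mkcond.
by apply: eq_bigr => p _; rewrite ltnS; case: leqP => _; rewrite ?mul1n ?mul0n.
Qed.

(** The ideal property puts the whole box below [(i, j, k)] inside [L]. *)
Lemma antivolumeE (L : {fset nat * nat * nat}) (i j k : nat) :
  solid_partition L -> (i, j, k) \in L ->
  antivolume L (i, j, k) = i.+1 * j.+1 * k.+1.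
Proof.
move=> hL ijkL; have [n L_bound] := fset_bound L.
have /and3P[lt_in lt_jn lt_kn] := L_bound _ _ _ ijkL.
rewrite /antivolume card_fset_filter (sum_fset_box _ _ _ L_bound) /=.
rewrite -mulnA -(sum_ord_leq_const _ _ _ lt_in); apply: eq_bigr => p _.
rewrite -(sum_ord_leq_const _ _ _ lt_jn) big_distrr; apply: eq_bigr => q _ /=.
rewrite -[k.+1]muln1 -(sum_ord_leq_const _ _ _ lt_kn) !big_distrr.
apply: eq_bigr => r _ /=; rewrite muln1.
case: leqP => [pi|_]; last by rewrite muln0.
case: leqP => [qj|_]; last by rewrite muln0.
case: leqP => [rk|_]; last by rewrite muln0.
by rewrite (hL _ _ _ _ _ _ ijkL).
Qed.

(** * Comparison of volumes with anti-volumes *)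

Lemma volume_dominates (L : {fset nat * nat * nat}) (t : nat) :
  solid_partition L ->
  \sum_(x <- L) (antivolume L x - t) <= \sum_(x <- L) (volume L x - t).
Proof.
move=> hL; have [n L_bound] := fset_bound L.
rewrite !(sum_fset_box _ _ _ L_bound).
pose c i j k : nat := (i, j, k) \in L.
have c_dec i j k i' j' k' : i <= i' -> j <= j' -> k <= k' ->
    c i' j' k' <= c i j k.
  move=> ii' jj' kk'; rewrite /c.
  by case: (boolP (_ \in L)) => // /hL ->.
apply: leq_trans (leq_trans (sum3_tail_dominates n t c c_dec) _).
  do 3![apply: leq_sum => ? _]; rewrite /c.
  case: (boolP (_ \in L)) => // ijkL.
  by rewrite antivolumeE // mul1n muln1.
apply: leq_sum => i _; apply: leq_sum => j _; apply: leq_sum => k _.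
rewrite -(volume_sum _ _ _ _ _ L_bound).
(* No point of [L] lies above a point outside [L], so the volume there is zero and the indicator
   weight loses nothing. *)
case: (boolP (_ \in L)) => [_|ijkNL]; first by rewrite mul1n.
rewrite /volume card_fset_filter big_seq big1 ?sub0n //= => -[[p q] r] pqrL /=.
by apply/eqP; rewrite eqb0; apply: contra ijkNL => /and3P[]; apply: hL.
Qed.

Theorem theorem5p3 (R : realType) (L : {fset nat * nat * nat})
    (hL : solid_partition L) :
  majorizes (volume_mset R L) (antivolume_mset R L).
Proof.
rewrite /volume_mset /antivolume_mset.
rewrite (map_comp (fun m => m%:R%R) (volume L)).
rewrite (map_comp (fun m => m%:R%R) (antivolume L)).
apply: majorizes_natr => [||t]; rewrite ?size_map ?big_map //.
- exact: sum_volume.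
- exact: volume_dominates.
Qed.
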